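(* Let $n\ge1$ and let $C(\sigma)$ denote the connectivity set of a permutation $\sigma$ chosen uniformly at random from $S_n$. The point process corresponding to $C(\sigma)\cup\{0,n\}$ is determinantal, with state space $\{0,\dots,n\}$ and correlation kernel $K(x,y)$ satisfying $$\begin{array}{ll} K(0,y)=1 & \text{for all } y,\\[2pt] K(n,y)=\delta_{n,y} & \text{for all } y,\\[2pt] K(x,y)=\dfrac{1}{\binom{n}{x}} & \text{if } x\ne 0,n \text{ and } x\le y,\\[8pt] K(x,y)=\dfrac{1}{\binom{n}{x}}-\dfrac{1}{\binom{n-y}{n-x}} & \text{if } x\neq 0,n \text{ and } x>y.\end{array}$$
   Context: For $\sigma\in S_n$, the connectivity set $C(\sigma)$ is the set of $i$, $1\le i\le n-1$, such that $\sigma\in S_{\{1,\dots,i\}}\times S_{\{i+1,\dots,n\}}$, i.e. $\sigma$ maps $\{1,\dots,i\}$ onto itself. A point process on a finite set $\mathcal{X}$ (a random subset $S$ of $\mathcal{X}$) is determinantal with correlation kernel $K$ if $P\{S\supseteq A\}=\det(K(x,y))_{x,y\in A}$ for every $A\subseteq\mathcal{X}$. *)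

(* Defs.v *)
From HB Require Import structures.
From mathcomp Require Import all_boot all_order all_fingroup all_algebra.
Set Implicit Arguments.
Unset Strict Implicit.
Unset Printing Implicit Defensive.
Import Order.TTheory GRing.Theory Num.Theory.
Local Open Scope ring_scope.

Record fdist (R : realFieldType) (T : finType) := FDist {
  pmf :> T -> R;
  pmf_ge0 : forall t, 0 <= pmf t;
  pmf_sum1 : \sum_t pmf t = 1 }.

Definition Pr (R : realFieldType) (T : finType) (P : fdist R T)
  (E : {set T}) : R := \sum_(t in E) P t.

Lemma uniform_ge0 (R : realFieldType) (T : finType) (t : T) :
  0 <= #|T|%:R^-1 :> R.
Proof. by rewrite invr_ge0 ler0n. Qed.

Lemma uniform_sum1 (R : realFieldType) (T : finType) (T_gt0 : (0 < #|T|)%N) :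
  \sum_(t : T) #|T|%:R^-1 = 1 :> R.
Proof.
by rewrite sumr_const -(mulr_natl (_^-1)) mulfV // pnatr_eq0 -lt0n.
Qed.

Definition uniform (R : realFieldType) (T : finType) (T_gt0 : (0 < #|T|)%N) :
  fdist R T := FDist (@uniform_ge0 R T) (uniform_sum1 R T_gt0).

Lemma card_perm_gt0 (n : nat) : (0 < #|{: 'S_n}|)%N.
Proof. by apply/card_gt0P; exists 1%g. Qed.

(* The point process is given as a random subset [S] of [X], defined on a
   finite probability space [(Omega, P)].  The determinant does not depend on
   the enumeration of [A]; it is 1 for empty [A]. *)
Definition determinantal (R : realFieldType) (Omega X : finType)
    (P : fdist R Omega) (S : Omega -> {set X}) (K : X -> X -> R) : Prop :=
  forall A : {set X},
    Pr P [set w | A \subset S w] =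
    \det (\matrix_(i < #|A|, j < #|A|) K (enum_val i) (enum_val j)).

(* ['I_n] is 0-based: [k : 'I_n] stands for the letter [k + 1], so the initial
   segment {1, ..., i} is [[set k : 'I_n | k < i]].  The positions [i] are not
   shifted; they are elements of {0, ..., n}. *)
Definition connectivity_set (n : nat) (s : 'S_n) : {set 'I_n.+1} :=
  [set i : 'I_n.+1 |
    (0 < i < n)%N && (s @: [set k : 'I_n | (k < i)%N] == [set k : 'I_n | (k < i)%N])].

Definition connectivity_kernel (R : realFieldType) (n : nat)
    (x y : 'I_n.+1) : R :=
  if x == ord0 then 1
  else if x == ord_max then (y == ord_max)%:R
  else if (x <= y)%N then 'C(n, x)%:R^-1
  else 'C(n, x)%:R^-1 - 'C(n - y, n - x)%:R^-1.

(* Main.v *)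
(* Writing g y x = (x - y)! (n - x)! / (n - y)! (step_ratio), the kernel is
   K(x, y) = g 0 x - [y < x] g y x for all x, y, including 0 and n. For a_1 <
   ... < a_k, subtracting the first column from the others makes the first row
   g 0 a_1, 0, ..., 0 and leaves a minor of the same shape with 0 replaced by
   a_1; hence the determinant is g 0 a_1 * g a_1 a_2 * ... * g a_(k-1) a_k.
   The permutations preserving every {1, ..., a_i} form a Young subgroup of
   order a_1! (a_2 - a_1)! ... (n - a_k)!, so their proportion is the same
   product. *)
Require Import Defs.
From mathcomp Require Import all_boot all_order all_fingroup all_algebra.
From mathcomp Require Import zify ring.
Set Implicit Arguments.
Unset Strict Implicit.
Unset Printing Implicit Defensive.
Import Order.TTheory GRing.Theory Num.Theory.
Local Open Scope ring_scope.

(** The base point [a 0] belongs to the sequence, so the remaining minor is the same matrix for the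
    shifted sequence and the induction applies. *)
Lemma det_chain_kernel (R : comNzRingType) (T : Type) (g : T -> T -> R)
    (k : nat) (a : nat -> T) :
  \det (\matrix_(i < k, j < k)
          (g (a 0%N) (a i.+1) - g (a j.+1) (a i.+1) *+ (j < i)%N)) =
  \prod_(i < k) g (a i) (a i.+1).
Proof.
elim: k a => [|k IHk] a; first by rewrite det_mx00 big_ord0.
rewrite big_ord_recl -(IHk (fun i => a i.+1)).
set M := \matrix_(i, j) _; set N := (X in _ = _ * \det X).
pose c : 'cV[R]_k := \col_i (g (a 0%N) (a i.+2) - g (a 1%N) (a i.+2)).
(* The right factor adds the first column to all the others; the left factor is thus the matrix
   after the column subtraction. *)
have -> : M = block_mx (g (a 0%N) (a 1%N))%:M 0 c N *m
              block_mx (1%:M : 'M_1) (const_mx 1) 0 1%:M :> 'M_(1 + k).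
  rewrite mulmx_block !mulmx1 !mulmx0 !addr0.
  apply/matrixP => i j; rewrite mxE.
  case: (split_ordP i) => i' ->; case: (split_ordP j) => j' ->.
  - by rewrite block_mxEul !ord1 !mxE /= subr0.
  - by rewrite block_mxEur mul_scalar_mx !ord1 !mxE /= subr0 mulr1.
  - by rewrite block_mxEdl !ord1 !mxE.
  - rewrite block_mxEdr !mxE big_ord1 !mxE /= mulr1 !add1n ltnS.
    by ring.
by rewrite det_mulmx (@det_lblock _ 1) (@det_ublock _ 1) !det1 !mulr1 det_scalar1.
Qed.

Section YoungSubgroup.
Variable n : nat.

Definition initseg (i : nat) : {set 'I_n} := [set k : 'I_n | (k < i)%N].

(** Holding the letters below [l] fixed lets a recursion on [s] peel off one block at a time from
    the left. *)
Definition young (l : nat) (s : seq 'I_n.+1) : {set 'S_n} :=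
  (Sym (~: initseg l) :&: \bigcap_(a <- s) 'N(initseg a | 'P))%g.

Lemma young_group_set l s : group_set (young l s).
Proof.
suff gN : group_set (\bigcap_(a <- s) 'N(initseg a | 'P))%g.
  exact: group_setI (Sym_group _) (Group gN).
elim: s => [|a s IHs]; first by rewrite big_nil group_setT.
by rewrite big_cons; exact: group_setI 'N(_ | _)%G (Group IHs).
Qed.
Canonical young_group l s := Group (young_group_set l s).

Lemma mem_young l s (p : 'S_n) :
  (p \in young l s) =
  perm_on (~: initseg l) p &&
  all (fun a : 'I_n.+1 => p \in ('N(initseg a | 'P))%g) s.
Proof.
rewrite /young inE inE; congr andb.
elim: s => [|a s IHs]; first by rewrite big_nil inE.
by rewrite big_cons inE IHs.
Qed.

Lemma stab_initsegP (i : nat) (p : 'S_n) :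
  reflect (forall x, (p x < i)%N = (x < i)%N) (p \in ('N(initseg i | 'P))%g).
Proof.
apply: (iffP idP) => [pN x|pE].
  by have := astabs_act x pN; rewrite !inE.
by apply/astabsP => x; rewrite !inE; exact: pE.
Qed.

Lemma perm_on_stab_initseg (B : {set 'I_n}) (b : nat) (p : 'S_n) :
  B \subset initseg b -> perm_on B p -> p \in ('N(initseg b | 'P))%g.
Proof.
move=> sBb pB; have pb := subset_trans pB sBb.
by apply/stab_initsegP => x; have := perm_closed x pb; rewrite !inE.
Qed.

(** An element of the left side fixes the letters below [l] and preserves those below [a], so it
    preserves the block [B] between them. Its restriction to [B] splits off. Conversely, the
    segments of [s] contain [B], so permutations of [B] preserve them. *)
Lemma young_cons l (a : 'I_n.+1) s :
    (l <= a)%N -> all (fun b : 'I_n.+1 => a <= b)%N s ->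
  young l (a :: s) = (Sym (initseg a :\: initseg l) * young a s)%g.
Proof.
move=> le_la /allP le_as; set B := _ :\: _.
have subB b : (a <= b)%N -> B \subset initseg b.
  by move=> le_ab; apply/subsetP => x; rewrite !inE => /andP[_ /leq_trans]; apply.
have stabB p (b : 'I_n.+1) :
    perm_on B p -> b \in s -> p \in ('N(initseg b | 'P))%g.
  by move=> pB /le_as /subB sBb; apply: perm_on_stab_initseg pB.
apply/setP => p; apply/idP/mulsgP => [|[t u]].
  rewrite mem_young /= => /and3P[pl pa /allP ps].
  have pNB : p \in ('N(B | 'P))%g.
    apply/astabsP => x; have := perm_closed x pl.
    by move/stab_initsegP: pa => /(_ x); rewrite !inE /= => -> ->.
  have tB := restr_perm_on B p; set t := restr_perm B p in tB.
  exists t (t^-1 * p)%g; rewrite ?mulKVg //; first by rewrite inE.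
  rewrite mem_young; apply/andP; split; last first.
    by apply/allP => b bs; rewrite groupM ?ps // groupV stabB.
  apply/subsetP => x; have [y ->] : exists y, x = t y.
    by exists (t^-1 x)%g; rewrite permKV.
  (* It remains to see that [p y = t y] whenever [t y < a]. On [B] this is the restriction; off [B],
     [t] fixes [y], which then lies below [l], where [p] is the identity. *)
  rewrite !inE permM permK; apply: contra => lt_ya.
  have [yB|yNB] := boolP (y \in B); first by rewrite restr_permE.
  rewrite (out_perm tB yNB) (out_perm pl) //.
  move: lt_ya yNB; rewrite !inE.
  have /stab_initsegP -> := perm_on_stab_initseg (subB _ (leqnn a)) tB.
  by move=> ->; rewrite andbT.
rewrite inE !mem_young /= => tB /andP[ua /allP us] ->.
apply/andP; split.
  apply: perm_onM.
    apply: subset_trans tB _; apply/subsetP => x /setDP[_].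
    by rewrite !inE.
  apply: subset_trans ua _; apply/subsetP => x; rewrite !inE -!leqNgt.
  exact: leq_trans.
apply/andP; split.
  rewrite groupM ?(perm_on_stab_initseg (subB _ (leqnn a)) tB) //.
  apply/stab_initsegP => x; have := perm_closed x ua; rewrite !inE.
  exact: negb_inj.
by apply/allP => b bs; rewrite groupM ?us // stabB.
Qed.

Lemma card_initseg (i : nat) : (i <= n)%N -> #|initseg i| = i.
Proof.
move=> le_in; rewrite -sum1dep_card -[RHS]card_ord -sum1_card.
by rewrite (big_ord_widen n (fun=> 1%N)).
Qed.

(** The two factors of [young_cons] move disjoint sets of letters, so they meet trivially and their
    orders multiply. *)
Lemma card_young_cons l (a : 'I_n.+1) s :
    (l <= a)%N -> all (fun b : 'I_n.+1 => a <= b)%N s ->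
  #|young l (a :: s)| = ((a - l)`! * #|young a s|)%N.
Proof.
move=> le_la le_as; have le_an : (a <= n)%N by rewrite -ltnS.
have sub_la : initseg l \subset initseg a.
  by apply/subsetP => x; rewrite !inE => /leq_trans; apply.
rewrite young_cons // TI_cardMg.
  rewrite card_Sym cardsD (setIidPr sub_la) !card_initseg //.
  exact: leq_trans le_an.
apply/trivgP/subsetP => p /setIP[]; rewrite inE mem_young => pB /andP[pa _].
apply/set1P/permP => x; rewrite perm1.
have [lt_xa|le_ax] := ltnP x a.
  by rewrite (out_perm pa) // !inE negbK.
by rewrite (out_perm pB) // !inE (leq_gtF le_ax) andbF.
Qed.

Lemma card_young_nil l : (l <= n)%N -> #|young l [::]| = (n - l)`!.
Proof.
move=> le_ln.
by rewrite /young big_nil setIT card_Sym cardsCs setCK card_initseg ?card_ord.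
Qed.

End YoungSubgroup.

(** For [l <= a <= n], the proportion of the permutations of the last [n - l] letters that preserve
    the first [a - l] of these. *)
Definition step_ratio (R : realFieldType) (n l a : nat) : R :=
  (a - l)`!%:R * (n - a)`!%:R / (n - l)`!%:R.

Lemma step_ratioE (R : realFieldType) (n l a : nat) :
  (l <= a <= n)%N -> step_ratio R n l a = 'C(n - l, n - a)%:R^-1.
Proof.
move=> /andP[le_la le_an].
have le_sub : (n - a <= n - l)%N by rewrite leq_sub2l.
rewrite /step_ratio -(bin_fact le_sub) !natrM.
have -> : (n - l - (n - a) = a - l)%N by lia.
have nzf k : k`!%:R != 0 :> R by rewrite pnatr_eq0 -lt0n fact_gt0.
have nzC : 'C(n - l, n - a)%:R != 0 :> R by rewrite pnatr_eq0 -lt0n bin_gt0.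
by field; rewrite nzC !nzf.
Qed.

(** The factor [(n - a)!] in the numerator of each step cancels the denominator left by the tail. *)
Lemma card_young_ratio (R : realFieldType) (n l : nat) (s : seq 'I_n.+1) :
    (l <= n)%N -> path leq l (map val s) ->
  #|young l s|%:R / (n - l)`!%:R =
  \prod_(i < size s)
     step_ratio R n (nth 0%N (l :: map val s) i)
       (nth 0%N (l :: map val s) i.+1).
Proof.
have nzf k : k`!%:R != 0 :> R by rewrite pnatr_eq0 -lt0n fact_gt0.
elim: s l => [|a s IHs] l le_ln /=.
  by rewrite card_young_nil // big_ord0 divff.
case/andP=> le_la path_as; have le_an : (a <= n)%N by rewrite -ltnS.
rewrite big_ord_recl /= -IHs // card_young_cons //; last first.
  by have := order_path_min leq_trans path_as; rewrite all_map.
by rewrite natrM /step_ratio; field; rewrite !nzf.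
Qed.

(** The two special rows fit the formula: nothing lies below 0, and [step_ratio] is 1 at [a = n], so
    row [n] is 1 - [y < n]. *)
Lemma connectivity_kernelE (R : realFieldType) (n : nat) (x y : 'I_n.+1) :
  connectivity_kernel R x y =
  step_ratio R n 0 x - step_ratio R n y x *+ (y < x)%N.
Proof.
have le_xn : (x <= n)%N by rewrite -ltnS.
have le_yn : (y <= n)%N by rewrite -ltnS.
rewrite step_ratioE // subn0 bin_sub // /connectivity_kernel.
case: eqP => [->|_]; first by rewrite ltn0 bin0 invr1 subr0.
case: eqP => [->|_] /=.
  rewrite binn invr1 -val_eqE /= ltn_neqAle le_yn andbT.
  case: eqP => [_|_] /=; first by rewrite subr0.
  by rewrite step_ratioE ?le_yn ?leqnn // subnn bin0 invr1 mulr1n subrr.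
case: leqP => [_|lt_yx]; first by rewrite subr0.
by rewrite step_ratioE // ltnW.
Qed.

(** Every permutation preserves the empty and the full segment, so adjoining 0 and [n] matches the
    conditions that membership in [young] imposes at these points. *)
Lemma sub_connectivity_set (n : nat) (s : 'S_n) (A : {set 'I_n.+1}) :
  (A \subset connectivity_set s :|: [set ord0; ord_max]) =
  (s \in young 0 (enum A)).
Proof.
have stab0 : s \in ('N(initseg n 0 | 'P))%g by apply/stab_initsegP.
have stabn : s \in ('N(initseg n n | 'P))%g.
  by apply/stab_initsegP => x; rewrite !ltn_ord.
have s0 : perm_on (~: initseg n 0) s.
  by apply/subsetP => x _; rewrite !inE.
have stabE (a : nat) : (s @: initseg n a == initseg n a) =
    (s \in ('N(initseg n a | 'P))%g).
  apply/eqP/idP => [sE|sN]; last exact: (astabs_setact sN).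
  apply/astabsP => x /=; rewrite -{1}sE.
  exact: (mem_imset _ _ (@perm_inj _ s)).
rewrite mem_young s0 /=; apply/subsetP/allP => sA a.
  rewrite mem_enum => /sA /setUP[]; first by rewrite inE stabE => /andP[].
  by case/set2P => ->.
rewrite -mem_enum => /sA sa; rewrite !inE stabE sa andbT.
rewrite -!val_eqE /= lt0n; case: eqP => //= _.
by rewrite orbC -leq_eqVlt -ltnS.
Qed.

Lemma enum_ord_sorted (n : nat) (A : {set 'I_n}) : sorted ltn (map val (enum A)).
Proof.
rewrite sorted_map {1}/enum_mem -enumT.
apply: sorted_filter; first by move=> ? ? ?; apply: ltn_trans.
by rewrite -sorted_map val_enum_ord iota_ltn_sorted.
Qed.

Theorem theorem5p4 (R : realFieldType) (n : nat) (n_ge1 : (1 <= n)%N) :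
  determinantal (uniform R (card_perm_gt0 n))
    (fun s : 'S_n => connectivity_set s :|: [set ord0; ord_max])
    (@connectivity_kernel R n).
Proof.
move=> A; rewrite /Pr /=.
under eq_bigl => s do rewrite inE sub_connectivity_set.
have lt_s := enum_ord_sorted A.
have path0 : path leq 0 (map val (enum A)).
  rewrite path_min_sorted ?(sub_sorted ltnW) //.
  by apply/allP.
rewrite sumr_const -(mulr_natl (_^-1)) card_Sn.
have := card_young_ratio R (leq0n n) path0; rewrite subn0 => ->.
(* The sequence is [A] in increasing order, preceded by the base point 0. *)
rewrite -cardE -(det_chain_kernel _ _ (nth 0%N (0%N :: map val (enum A)))).
congr (\det _); apply/matrixP => i j; rewrite !mxE connectivity_kernelE /=.
have valE (h : 'I_#|A|) : nth 0%N (map val (enum A)) h = enum_val h :> nat.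
  by rewrite (nth_map ord0) -?cardE // (enum_val_nth ord0).
(* The determinant lemma compares positions and the kernel compares elements; these agree because
   [enum A] is increasing. *)
suff -> : (j < i)%N = (enum_val j < enum_val i)%N by rewrite -!valE.
have homo := sorted_ltn_nth ltn_trans 0%N lt_s.
have lt_val (h h' : 'I_#|A|) : (h < h')%N -> (enum_val h < enum_val h')%N.
  by rewrite -!valE; apply: homo; rewrite inE size_map -cardE.
have [/lt_val ->|/lt_val /ltnW/leq_gtF ->|/val_inj ->] // := ltngtP j i.
by rewrite ltnn.
Qed.
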